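(* Let $p$ be a prime, $n\ge 1$, $k>1$ integers, and let $A,B\in\mathbb{Z}^{n\times n}$ be integer matrices with $\gcd(A,B,p)=1$ (i.e. $p$ does not divide all the entries of both $A$ and $B$). (1) If $k=2l$, then $$K_n(A,B;p^k)=\sum_{X}\psi\big((AX+X^{-1}B)/p^k\big),$$ where the sum is over those $X\in GL_n(\mathbb{Z}/p^k\mathbb{Z})$ satisfying $XAX\equiv B \pmod{p^l}$. (2) If $k=2l+1$, then $$K_n(A,B;p^k)=\frac{1}{p^{n^2}}\sum_{X}\psi\big((AX+X^{-1}B)/p^k\big)\,S_{A,B}(X;p),$$ where the sum is over those $X\in GL_n(\mathbb{Z}/p^k\mathbb{Z})$ satisfying $XAX\equiv B\pmod{p^l}$, and where $$S_{A,B}(X;p)=\sum_{U \bmod p}\psi\big((SU+TU^2)/p\big),$$ the sum being over all $n\times n$ matrices $U$ modulo $p$, with $S=(AX-X^{-1}B)/p^l$ and $T=AX$.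
   Context: For an $n\times n$ matrix $M$ write $\psi(M)=e^{2\pi i\operatorname{Tr}M}$; for a matrix $M$ over $\mathbb{Z}/p^k\mathbb{Z}$ the value $\psi(M/p^k)$ is well defined (lift $M$ to an integer matrix). The matrix Kloosterman sum is $$K_n(A,B;p^k)=\sum_{X\in GL_n(\mathbb{Z}/p^k\mathbb{Z})}\psi\big((AX+X^{-1}B)/p^k\big).$$ When $XAX\equiv B \pmod{p^l}$, the matrix $AX-X^{-1}B$ over $\mathbb{Z}/p^k\mathbb{Z}$ is divisible by $p^l$, and in (2) the quotient $S=(AX-X^{-1}B)/p^l$ is well defined modulo $p^{l+1}$; $S$ and $T$ are used only modulo $p$. *)

(* Defs.v *)
From mathcomp Require Import all_boot all_order all_algebra.
From mathcomp Require Import all_classical all_reals all_analysis.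
From mathcomp Require Export complex.

Set Implicit Arguments.
Unset Strict Implicit.
Unset Printing Implicit Defensive.

Import Order.TTheory GRing.Theory Num.Theory.
Local Open Scope ring_scope.

(* For m >= 2, 'Z_m is Z/mZ.  Every modulus in use is p ^ j with p prime and
   j >= 1. *)

(* The integer lift of M whose entries lie in {0, ..., m - 1}. *)
Definition liftmx (m n : nat) (M : 'M['Z_m]_n) : 'M[int]_n :=
  map_mx (fun x : 'Z_m => (nat_of_ord x)%:Z) M.

Definition redmx (m n : nat) (M : 'M[int]_n) : 'M['Z_m]_n :=
  map_mx (fun z : int => z%:~R : 'Z_m) M.
Arguments redmx m {n} M.

Definition eqmx_mod (d n : nat) (M N : 'M[int]_n) : bool :=
  [forall i, forall j, (M i j == N i j %[mod d%:Z])%Z].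

(* e^{2 pi i Tr M}, written out with Euler's formula. *)
Definition psi (R : realType) (n : nat) (M : 'M[R]_n) : R[i] :=
  Complex (cos (2 * pi * \tr M)) (sin (2 * pi * \tr M)).

(* psi (M / m) for M over Z/mZ: another lift changes Tr (M / m) by an integer,
   so the value does not depend on the one chosen. *)
Definition psi_mod (R : realType) (m n : nat) (M : 'M['Z_m]_n) : R[i] :=
  psi (m%:R^-1 *: map_mx (fun z : int => z%:~R : R) (liftmx M)).
Arguments psi_mod R {m n} M.

Section Kloosterman.
Variables (R : realType) (n : nat) (A B : 'M[int]_n).

Definition kterm (m : nat) (X : 'M['Z_m]_n) : R[i] :=
  psi_mod R (redmx m A *m X + invmx X *m redmx m B).

Definition kloosterman (m : nat) : R[i] :=
  \sum_(X : 'M['Z_m]_n | X \in unitmx) kterm X.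

(* X A X = B (mod d); for d dividing m this does not depend on the lift. *)
Definition XAX_eq_mod (m d : nat) (X : 'M['Z_m]_n) : bool :=
  eqmx_mod d (liftmx X *m A *m liftmx X) B.

(* (A X - X^-1 B) / d as an integer matrix.  The division is exact when
   XAX_eq_mod d X holds and d divides m; the quotient is then well defined
   modulo m / d. *)
Definition Smx (m d : nat) (X : 'M['Z_m]_n) : 'M[int]_n :=
  map_mx (fun z : int => (z %/ d%:Z)%Z)
    (liftmx (redmx m A *m X - invmx X *m redmx m B)).

Definition Tmx (m : nat) (X : 'M['Z_m]_n) : 'M[int]_n := A *m liftmx X.

Definition gauss_sum (p m d : nat) (X : 'M['Z_m]_n) : R[i] :=
  \sum_(U : 'M['Z_p]_n)
    psi_mod R (redmx p (Smx d X) *m U + redmx p (Tmx X) *m (U *m U)).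

End Kloosterman.
Arguments kterm R {n} A B {m} X.
Arguments kloosterman R {n} A B m.
Arguments XAX_eq_mod {n} A B {m} d X.
Arguments Smx {n} A B {m} d X.
Arguments Tmx {n} A {m} X.
Arguments gauss_sum R {n} A B p {m} d X.

(* Main.v *)
Require Import Defs.
From mathcomp Require Import all_boot all_order all_algebra.
From mathcomp Require Import all_classical all_reals all_analysis.
From mathcomp Require Import ring lra zify.
Import Order.TTheory GRing.Theory Num.Theory.
Local Open Scope ring_scope.

(** The idea is a stationary phase argument.  Put m = p^k, d = p^l and
    D = A X - X^-1 B, C = X^-1 B over Z/m.  As l >= 1, the cube of d vanishes
    modulo m, so 1 + d U is invertible with inverse 1 - d U + d^2 U^2 for every
    matrix U, and
<<
      Tr (A Y + Y^-1 B) =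
        Tr (A X + X^-1 B) + d Tr (D U) + d^2 Tr (C U^2),    Y = X (1 + d U).
>>
    For fixed U the map X |-> Y permutes GL_n(Z/m).  Averaging the Kloosterman
    sum over all U therefore multiplies the term of X by the mean over U of the
    character at d Tr (D U) + d^2 Tr (C U^2) ([kloosterman_average]).

    Write m = d^2 r, so that r = 1 if k = 2 l and r = p if k = 2 l + 1.  The
    translation U |-> U + r V leaves d^2 Tr (C U^2) unchanged modulo m and adds
    d r Tr (D V) to the phase.  Hence the inner sum vanishes unless
    d r D = 0 modulo m ([quad_sum_eq0]), that is, unless X A X = B modulo d
    ([XAX_eq_modP]); this gives the restriction on X
    ([kloosterman_localized]).

    On the remaining X, the phase is zero when r = 1 ([quad_sum_even]).  When
    r = p it equals d^2 Tr (S U + T U^2), where D = d S, and where C may be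
    replaced by T = A X = C + D because d^2 D = 0.  This depends on U modulo p
    only, and the inner sum is a multiple of the sum over U modulo p
    ([quad_sum_odd]). *)

(** * The additive character of Z/m *)

(** The exponential e(t) = e^(2 pi i t), of period 1. *)
Definition expi (R : realType) (t : R) : R[i] :=
  Complex (cos (2 * pi * t)) (sin (2 * pi * t)).

Lemma expiD (R : realType) (s t : R) : expi R (s + t) = expi R s * expi R t.
Proof.
rewrite /expi (mulrDr (2 * pi) s t) cosD sinD; congr Complex.
by rewrite addrC [cos (2 * pi * s) * _]mulrC.
Qed.

Lemma expi0 (R : realType) : expi R 0 = 1.
Proof. by rewrite /expi mulr0 cos0 sin0. Qed.

Lemma expi_int (R : realType) (z : int) : expi R z%:~R = 1.
Proof.
have expi_nat (j : nat) : expi R j%:R = 1.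
  elim: j => [|j IHj]; first by rewrite expi0.
  rewrite -[j.+1]addn1 natrD expiD IHj mul1r /expi mulr1 mulr_natl.
  by rewrite cos2pi sin2pi.
have [j [->|->]] : exists j : nat, z = j%:Z \/ z = - j%:Z.
  by exists `|z|%N; lia.
- by rewrite -pmulrn.
- have := expiD R j%:R (- j%:Z)%:~R.
  by rewrite expi_nat mul1r rmorphN /= -pmulrn subrr expi0.
Qed.

(** The cosine duplication formula turns cos (2 pi t) = 1 into sin (pi t) = 0,
    while the sine is positive on ]0, pi[. *)
Lemma expi_eq1 (R : realType) (t : R) : 0 <= t < 1 -> expi R t = 1 -> t = 0.
Proof.
case/andP=> t_ge0 t_lt [cos1 _]; apply/eqP; rewrite eq_le t_ge0 andbT leNgt.
apply/negP=> t_gt0.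
have pi_gt0 := pi_gt0 R.
have sin_gt0 : 0 < sin (pi * t) by apply: sin_gt0_pi; apply/andP; split; nra.
have := cos2Dsin2 (pi * t); have := cos_mulr2n (pi * t).
have -> : pi * t *+ 2 = 2 * pi * t by ring.
by rewrite cos1; nra.
Qed.

Lemma intr_Zp_eq0 (m : nat) (z : int) :
  (1 < m)%N -> (z%:~R == 0 :> 'Z_m) = (m%:Z %| z)%Z.
Proof.
move=> m_gt1; have nat_eq0 (j : nat) : (j%:R == 0 :> 'Z_m) = (m %| j)%N.
  by rewrite -val_eqE /= val_Zp_nat.
case: (intP z) => [|j|j]; first by rewrite dvdz0 eqxx.
- by rewrite -pmulrn nat_eq0.
- by rewrite rmorphN /= oppr_eq0 -pmulrn nat_eq0.
Qed.

Definition zchar (R : realType) (m : nat) (x : 'Z_m) : R[i] :=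
  expi R ((x : nat)%:R / m%:R).

(** The character may be computed on any integer representative, since e has
    period 1. *)
Lemma zchar_int (R : realType) (m : nat) (z : int) :
  (1 < m)%N -> zchar R m z%:~R = expi R (z%:~R / m%:R).
Proof.
move=> m_gt1; rewrite /zchar; set x := nat_of_ord _.
have /dvdzP[q q_eq] : (m%:Z %| z - x%:Z)%Z.
  rewrite -intr_Zp_eq0 // rmorphB /= -pmulrn subr_eq0; apply/eqP.
  by rewrite {}/x; exact: esym (natr_Zp _).
have -> : z = x%:Z + q * m%:Z by rewrite -q_eq addrC subrK.
have m_neq0 : m%:R != 0 :> R by rewrite pnatr_eq0; lia.
rewrite rmorphD rmorphM /= -!pmulrn [(_ + _) / _]mulrDl mulfK // expiD expi_int.
by rewrite mulr1.
Qed.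

Lemma intr_Zp_val (m : nat) (x : 'Z_m) : ((x : nat)%:Z)%:~R = x.
Proof. by rewrite -pmulrn natr_Zp. Qed.

Lemma zcharD (R : realType) (m : nat) (x y : 'Z_m) :
  (1 < m)%N -> zchar R m (x + y) = zchar R m x * zchar R m y.
Proof.
move=> m_gt1; rewrite -[x in LHS]intr_Zp_val -[y in LHS]intr_Zp_val -rmorphD.
rewrite zchar_int // rmorphD /= [(_ + _) / _]mulrDl expiD -!pmulrn.
by rewrite /zchar.
Qed.

Lemma zchar0 (R : realType) (m : nat) : zchar R m 0 = 1.
Proof. by rewrite /zchar mul0r expi0. Qed.

(** Faithfulness of the character: it is what makes the sums below vanish off
    the stationary points. *)
Lemma zchar_eq1 (R : realType) (m : nat) (x : 'Z_m) :
  (1 < m)%N -> zchar R m x = 1 -> x = 0.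
Proof.
move=> m_gt1 /expi_eq1 x_eq0.
have m_gt0 : 0 < m%:R :> R by rewrite ltr0n ltnW.
have x_lt : (x < m)%N by rewrite -[ltnRHS](Zp_cast m_gt1).
have /eqP : (x : nat)%:R / m%:R = 0 :> R.
  apply: x_eq0; rewrite divr_ge0 ?ler0n //=.
  by rewrite ltr_pdivrMr // mul1r ltr_nat.
rewrite mulf_eq0 invr_eq0 (gt_eqF m_gt0) orbF pnatr_eq0.
by move=> /eqP x0; apply: val_inj.
Qed.

(** * Lifting and reducing matrices *)

Lemma liftmxK (m n : nat) : cancel (@liftmx m n) (redmx m).
Proof. by move=> M; apply/matrixP=> i j; rewrite !mxE intr_Zp_val. Qed.

Lemma redmxD (m n : nat) (M N : 'M[int]_n) :
  redmx m (M + N) = redmx m M + redmx m N.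
Proof. exact: map_mxD. Qed.

Lemma redmxM (m n : nat) (M N : 'M[int]_n) :
  redmx m (M *m N) = redmx m M *m redmx m N.
Proof. exact: map_mxM. Qed.

Lemma trace_redmx (m n : nat) (M : 'M[int]_n) :
  \tr (redmx m M) = (\tr M)%:~R.
Proof. by rewrite trace_map_mx. Qed.

Lemma redmx_eq (m n : nat) (M N : 'M[int]_n) : (1 < m)%N ->
  (redmx m M = redmx m N) <-> (forall i j, (m%:Z %| M i j - N i j)%Z).
Proof.
move=> m_gt1; split=> [/matrixP eqMN i j | dvdMN].
  rewrite -intr_Zp_eq0 // rmorphB /= subr_eq0.
  by move: (eqMN i j); rewrite !mxE => ->.
apply/matrixP=> i j; rewrite !mxE; apply/eqP.
by rewrite -subr_eq0 -rmorphB intr_Zp_eq0.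
Qed.

Lemma redmx_liftmx_redmx (m d n : nat) (M : 'M[int]_n) :
  (1 < m)%N -> (1 < d)%N -> (d %| m)%N ->
  redmx d (liftmx (redmx m M)) = redmx d M.
Proof.
move=> m_gt1 d_gt1 d_m; apply/redmx_eq=> // i j.
apply: (@dvdz_trans m%:Z) => //.
by apply: (iffLR (redmx_eq m n _ _ m_gt1)); rewrite liftmxK.
Qed.

(** The integer lift of M has a trace that represents the trace of M modulo m,
    and the character does not depend on the representative. *)
Lemma psi_modE (R : realType) (m n : nat) (M : 'M['Z_m]_n) :
  (1 < m)%N -> psi_mod R M = zchar R m (\tr M).
Proof.
move=> m_gt1; rewrite -[in RHS](liftmxK m n M) trace_redmx zchar_int //.
rewrite /psi_mod /psi /expi mxtraceZ trace_map_mx.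
by rewrite [_^-1 * _]mulrC.
Qed.

(** * Multiplying X by 1 + q U *)

(** A geometric series that stops because the cube of q U is zero. *)
Lemma unipotent_inv (K : comUnitRingType) (n : nat) (q : K) (U : 'M[K]_n) :
  q ^+ 3 = 0 ->
  (1%:M + q *: U) *m (1%:M - q *: U + q ^+ 2 *: (U *m U)) = 1%:M.
Proof.
move=> q3; rewrite !mulmxDl !mulmxDr !mul1mx mulmx1 mulmxN.
rewrite -!scalemxAl -!scalemxAr !scalerA -expr2 -exprS q3 scale0r addr0.
by rewrite -[1%:M - _ + _]addrA [- _ + _]addrC -[_ - q *: U]opprB subrK.
Qed.

Lemma invmx_uniq (K : comUnitRingType) (n : nat) (X Y : 'M[K]_n) :
  X *m Y = 1%:M -> invmx X = Y.
Proof.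
move=> XY1; have [X_unit _] := mulmx1_unit XY1.
by rewrite -[LHS]mulmx1 -XY1 mulKmx.
Qed.

Section Terms.
Variables (R : realType) (m n : nat).
Implicit Types (C D S T U V X : 'M['Z_m]_n) (q r : 'Z_m).

(** The derivative of Tr (A X + X^-1 B) in the direction X U is Tr (D U) for
    this matrix D. *)
Definition defect (A B : 'M[int]_n) X : 'M['Z_m]_n :=
  redmx m A *m X - invmx X *m redmx m B.

Definition quad_phase q D C U : 'Z_m :=
  q * \tr (D *m U) + q ^+ 2 * \tr (C *m (U *m U)).

Definition quad_sum q D C : R[i] :=
  \sum_(U : 'M['Z_m]_n) zchar R m (quad_phase q D C U).

(** Second order expansion of the phase, exact because q^3 = 0; cyclicity of the
    trace gathers the two first order terms into Tr (D U). *)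
Lemma kterm_shift (A B : 'M[int]_n) q U X : (1 < m)%N -> q ^+ 3 = 0 ->
  X \in unitmx ->
  kterm R A B (X *m (1%:M + q *: U)) =
  kterm R A B X *
    zchar R m (quad_phase q (defect A B X) (invmx X *m redmx m B) U).
Proof.
move=> m_gt1 q3 X_unit; rewrite /kterm !psi_modE // -zcharD //.
have -> : invmx (X *m (1%:M + q *: U)) =
          (1%:M - q *: U + q ^+ 2 *: (U *m U)) *m invmx X.
  apply: invmx_uniq; rewrite mulmxA -(mulmxA X) unipotent_inv //.
  by rewrite mulmx1 mulmxV.
rewrite -mulmxA /defect; set C := invmx X *m _; rewrite /quad_phase.
rewrite mulmxDr mulmx1 -scalemxAr mulmxDr mulmxBl mulmxDl mulmxBl mul1mx.
rewrite -!scalemxAl -!scalemxAr !raddfD !raddfN /= !mxtraceZ mulmxA.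
rewrite [\tr (U *m C)]mxtrace_mulC [\tr (U *m U *m C)]mxtrace_mulC.
by congr zchar; ring.
Qed.

(** For each U the map X |-> X (1 + q U) permutes the invertible matrices; the
    identity is the sum over U of the resulting expressions of the Kloosterman
    sum, and m^(n^2) is the number of matrices U. *)
Lemma kloosterman_average (A B : 'M[int]_n) q : (1 < m)%N -> q ^+ 3 = 0 ->
  (m ^ (n * n))%:R * kloosterman R A B m =
  \sum_(X : 'M['Z_m]_n | X \in unitmx)
    kterm R A B X * quad_sum q (defect A B X) (invmx X *m redmx m B).
Proof.
move=> m_gt1 q3.
transitivity (\sum_(U : 'M['Z_m]_n) kloosterman R A B m).
  by rewrite sumr_const card_mx card_ord Zp_cast // mulr_natl.
under [RHS]eq_bigr do rewrite mulr_sumr.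
rewrite [RHS]exchange_big; apply: eq_bigr => U _.
have [U1_unit _] := mulmx1_unit (unipotent_inv _ _ q U q3).
rewrite [LHS](reindex (mulmx^~ (1%:M + q *: U))) /=; last first.
  exists (mulmx^~ (invmx (1%:M + q *: U))) => X _.
    exact: mulmxK.
  exact: mulmxKV.
rewrite (eq_bigl (mem unitmx)) => [|X]; last first.
  by rewrite unitmx_mul U1_unit andbT.
by apply: eq_bigr => X X_unit; rewrite kterm_shift.
Qed.

(** * The inner quadratic sum *)

Lemma quad_phase_shift q r D C U V : q ^+ 2 * r = 0 ->
  quad_phase q D C (U + r *: V) = quad_phase q D C U + q * r * \tr (D *m V).
Proof.
move=> q2r; rewrite /quad_phase mulmxDr mulmxDl !mulmxDr.
rewrite -!scalemxAl -!scalemxAr !raddfD /= !mxtraceZ.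
rewrite !(mulrDr (q ^+ 2)) !(mulrA (q ^+ 2)) q2r !mul0r.
by ring.
Qed.

(** The quadratic coefficient matters only through its product with q^2, and the
    linear one is divisible by q: in the odd case this brings out S and T. *)
Lemma quad_phase_factor q D C S T U :
  D = q *: S -> q ^+ 2 *: C = q ^+ 2 *: T ->
  quad_phase q D C U = q ^+ 2 * \tr (S *m U + T *m (U *m U)).
Proof.
move=> -> eqCT; rewrite /quad_phase mxtraceD mulrDr -scalemxAl mxtraceZ mulrA.
rewrite -expr2; congr (_ + _).
by rewrite -!mxtraceZ !scalemxAl eqCT.
Qed.

(** Translating U by r V multiplies the sum by the character at q r Tr (D V).
    If q r D has a nonzero entry, then V can be taken to be the elementary
    matrix for which that trace is this entry, and the factor differs
    from 1. *)
Lemma quad_sum_eq0 q r D C : (1 < m)%N -> q ^+ 2 * r = 0 ->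
  (q * r) *: D != 0 -> quad_sum q D C = 0.
Proof.
move=> m_gt1 q2r D_neq0.
have [i [j Dij]] : exists i j, ((q * r) *: D) i j != 0.
  apply/not_existsP => all0; case/eqP: D_neq0; apply/matrixP=> i j.
  rewrite [RHS]mxE; apply/eqP/negP => /negP Dij.
  by case: (all0 i); exists j.
(* Transposed indices: the trace of D V is then the (i, j) entry of D. *)
set V : 'M['Z_m]_n := delta_mx j i; pose w := zchar R m (q * r * \tr (D *m V)).
have w_neq1 : 1 - w != 0.
  rewrite subr_eq0 eq_sym; apply: contraNneq Dij => /zchar_eq1 => /(_ m_gt1).
  rewrite mxE /V => <-; apply/eqP; congr (_ * _); symmetry.
  rewrite /mxtrace (bigD1 i) //= mxE (bigD1 j) //= mxE !eqxx mulr1.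
  rewrite big1 => [|k /negPf k_j]; last by rewrite mxE k_j mulr0.
  rewrite big1 ?addr0 // => k /negPf k_i; rewrite mxE big1 // => a _.
  by rewrite mxE k_i andbF mulr0.
have shift : quad_sum q D C = quad_sum q D C * w.
  rewrite {1}/quad_sum (reindex_inj (addIr (r *: V))) /= mulr_suml.
  by apply: eq_bigr => U _; rewrite quad_phase_shift // zcharD.
apply/eqP; rewrite -(mulIr_eq0 _ (mulIf w_neq1)) mulrBr mulr1 -shift.
by rewrite subrr.
Qed.

End Terms.
Arguments defect {m n} A B X.

(** * Stationary points *)

Lemma intr_Zp_scale_eq0 (m d e : nat) (z : int) :
  (1 < m)%N -> m = (d * e)%N ->
  ((e%:Z * z)%:~R == 0 :> 'Z_m) = (d%:Z %| z)%Z.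
Proof.
move=> m_gt1 m_eq; have e_neq0 : e%:Z != 0 by lia.
by rewrite intr_Zp_eq0 // m_eq PoszM [d%:Z * _]mulrC dvdz_mul2l.
Qed.

(** D = X^-1 (X A X - B) with X invertible, and a residue modulo d e is a
    multiple of d exactly when e kills it.  So the congruence modulo d, stated
    with integer lifts, becomes a linear condition on D. *)
Lemma XAX_eq_modP (m d e n : nat) (A B : 'M[int]_n) (X : 'M['Z_m]_n) :
  (1 < m)%N -> m = (d * e)%N -> X \in unitmx ->
  XAX_eq_mod A B d X =
  (e%:R *: defect A B X == 0).
Proof.
move=> m_gt1 m_eq X_unit.
have -> : defect A B X =
    invmx X *m redmx m (liftmx X *m A *m liftmx X - B).
  rewrite /defect redmxD !redmxM.
  rewrite (_ : redmx m (- B) = - redmx m B); last exact: map_mxN.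
  by rewrite liftmxK mulmxDr mulmxN -!mulmxA mulKmx.
set W := _ - B; rewrite scalemxAr.
have -> : (invmx X *m (e%:R *: redmx m W) == 0) = (e%:R *: redmx m W == 0).
  apply/eqP/eqP => [W0|->]; last by rewrite mulmx0.
  by rewrite -[LHS](mulKVmx X_unit) W0 mulmx0.
have scaled_eq0 z : ((e%:Z * z)%:~R == 0 :> 'Z_m) = (d%:Z %| z)%Z.
  exact: intr_Zp_scale_eq0.
apply/forallP/eqP => [modW|/matrixP W0 i].
  apply/matrixP=> i j; rewrite !mxE pmulrn -rmorphM; apply/eqP.
  rewrite scaled_eq0; have /forallP/(_ j) := modW i.
  by rewrite eqz_mod_dvd !mxE.
apply/forallP=> j; rewrite eqz_mod_dvd -scaled_eq0; apply/eqP.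
have := W0 i j; rewrite mxE [redmx _ _ _ _]mxE [RHS]mxE pmulrn -rmorphM.
by rewrite !mxE.
Qed.

(** Once e kills D, the entries of D are multiples of d, and the integer division
    that defines S is exact. *)
Lemma Smx_exact (m d e n : nat) (A B : 'M[int]_n) (X : 'M['Z_m]_n) :
  (1 < m)%N -> m = (d * e)%N ->
  e%:R *: defect A B X = 0 ->
  d%:R *: redmx m (Smx A B d X) = defect A B X.
Proof.
move=> m_gt1 m_eq; rewrite /Smx -/(defect A B X).
move: (defect _ _ _) => D /matrixP D0.
apply/matrixP=> i j; rewrite !mxE pmulrn -rmorphM mulrC divzK.
  exact: intr_Zp_val.
rewrite -(intr_Zp_scale_eq0 m d e) //; apply/eqP.
by have := D0 i j; rewrite mxE [RHS]mxE rmorphM /= -pmulrn intr_Zp_val.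
Qed.

(** * Reduction of the inner sum modulo p *)

Lemma zchar_scaled (R : realType) (m d e : nat) (z : int) :
  (1 < m)%N -> (1 < d)%N -> m = (e * d)%N ->
  zchar R m (e%:R * z%:~R) = zchar R d z%:~R.
Proof.
move=> m_gt1 d_gt1 m_eq; rewrite pmulrn -rmorphM !zchar_int //.
have e_neq0 : e%:R != 0 :> R by rewrite pnatr_eq0; lia.
have d_neq0 : d%:R != 0 :> R by rewrite pnatr_eq0; lia.
congr expi; rewrite m_eq natrM rmorphM /= -pmulrn.
by field; rewrite e_neq0 d_neq0.
Qed.

(** Reduction modulo p has fibres of equal size.  Instead of counting a fibre,
    sum over U modulo m and W modulo p of g (U + W): either variable can be
    translated away. *)
Lemma sum_redmx_liftmx (V : nmodType) (m p n : nat) (g : 'M['Z_p]_n -> V) :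
  (1 < m)%N -> (1 < p)%N -> (p %| m)%N ->
  (\sum_(U : 'M['Z_m]_n) g (redmx p (liftmx U))) *+ p ^ (n * n) =
  (\sum_(U : 'M['Z_p]_n) g U) *+ m ^ (n * n).
Proof.
move=> m_gt1 p_gt1 p_m.
have card_M d : (1 < d)%N -> #|'M['Z_d]_n| = (d ^ (n * n))%N.
  by move=> d_gt1; rewrite card_mx card_ord Zp_cast.
rewrite -!card_M // -!sumr_const.
under eq_bigr => W _.
  rewrite (reindex_inj (addIr (redmx m (liftmx W)))) /=.
  under eq_bigr => U _.
    rewrite -{1}[U]liftmxK -redmxD redmx_liftmx_redmx // redmxD liftmxK.
    over.
  over.
rewrite exchange_big; apply: eq_bigr => U _.
by rewrite [RHS](reindex_inj (addrI (redmx p (liftmx U)))).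
Qed.

(** As the character of Z/m at e x is that of Z/p at x, the summand depends on U
    modulo p only. *)
Lemma quad_sum_reduce (R : realType) (m p e n : nat) (S T : 'M[int]_n) :
  (1 < m)%N -> (1 < p)%N -> m = (e * p)%N ->
  (p ^ (n * n))%:R *
    (\sum_(U : 'M['Z_m]_n)
      zchar R m (e%:R * \tr (redmx m S *m U + redmx m T *m (U *m U)))) =
  (m ^ (n * n))%:R *
    \sum_(U : 'M['Z_p]_n)
      psi_mod R (redmx p S *m U + redmx p T *m (U *m U)).
Proof.
move=> m_gt1 p_gt1 m_eq.
have p_m : (p %| m)%N by rewrite m_eq dvdn_mull.
rewrite !mulr_natl -(sum_redmx_liftmx _ m p n) //; congr (_ *+ _).
apply: eq_bigr => U _; rewrite -{1 2 3}(liftmxK m n U).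
by rewrite psi_modE // -!redmxM -!redmxD !trace_redmx (zchar_scaled R m p e).
Qed.

(** * The localized sums *)

(** The averaging identity with q = d.  That r divides d makes the cube of d a
    multiple of m = d^2 r, as the expansion of the phase requires. *)
Lemma kloosterman_localized (R : realType) (m d r n : nat) (A B : 'M[int]_n) :
  (1 < m)%N -> m = (d * (d * r))%N -> (r %| d)%N ->
  (m ^ (n * n))%:R * kloosterman R A B m =
  \sum_(X : 'M['Z_m]_n | (X \in unitmx) && XAX_eq_mod A B d X)
    kterm R A B X * quad_sum R m n d%:R (defect A B X) (invmx X *m redmx m B).
Proof.
move=> m_gt1 m_eq /dvdnP[s d_eq].
have m_eq0 : m%:R = 0 :> 'Z_m.
  by apply/eqP; rewrite pmulrn intr_Zp_eq0 // dvdzz.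
have d2r : (d%:R : 'Z_m) ^+ 2 * r%:R = 0.
  by rewrite -natrX -natrM -mulnn -mulnA -m_eq.
have d3 : (d%:R : 'Z_m) ^+ 3 = 0.
  by rewrite exprSr {2}d_eq mulnC natrM mulrA d2r mul0r.
rewrite (kloosterman_average R m n A B d%:R) // big_mkcondr /=.
apply: eq_bigr => X X_unit.
rewrite (XAX_eq_modP _ _ (d * r)) //; case: eqP => // /eqP D_neq0.
by rewrite (quad_sum_eq0 R m n _ r%:R) ?mulr0 // -natrM.
Qed.

Lemma quad_sum_even (R : realType) (m d n : nat) (A B : 'M[int]_n)
    (X : 'M['Z_m]_n) :
  (1 < m)%N -> m = (d * d)%N -> X \in unitmx -> XAX_eq_mod A B d X ->
  quad_sum R m n d%:R (defect A B X) (invmx X *m redmx m B) =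
  (m ^ (n * n))%:R.
Proof.
move=> m_gt1 m_eq X_unit; rewrite (XAX_eq_modP _ _ d) // => /eqP D0.
have d2 : (d%:R : 'Z_m) ^+ 2 = 0.
  by apply/eqP; rewrite -natrX -mulnn -m_eq pmulrn intr_Zp_eq0 // dvdzz.
rewrite /quad_sum (eq_bigr (fun=> 1)) => [|U _].
  by rewrite sumr_const card_mx card_ord Zp_cast.
rewrite /quad_phase -mxtraceZ scalemxAl D0 mul0mx mxtrace0 d2 mul0r addr0.
exact: zchar0.
Qed.

Lemma quad_sum_odd (R : realType) (m d p n : nat) (A B : 'M[int]_n)
    (X : 'M['Z_m]_n) :
  (1 < m)%N -> (1 < p)%N -> m = (d * (d * p))%N -> (p %| d)%N ->
  X \in unitmx -> XAX_eq_mod A B d X ->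
  (p ^ (n * n))%:R *
    quad_sum R m n d%:R (defect A B X) (invmx X *m redmx m B) =
  (m ^ (n * n))%:R * gauss_sum R A B p d X.
Proof.
move=> m_gt1 p_gt1 m_eq /dvdnP[s d_eq] X_unit.
rewrite (XAX_eq_modP _ _ (d * p)) // => /eqP D0.
rewrite /gauss_sum -(quad_sum_reduce R m p (d ^ 2)) //; last first.
  by rewrite -mulnn -mulnA.
congr (_ * _); apply: eq_bigr => U _; congr zchar; rewrite natrX.
apply: quad_phase_factor; first by rewrite (Smx_exact _ _ (d * p)).
(* The multiple d^2 = s (d p) of d p kills D, so that C and C + D = A X agree
   after multiplication by d^2. *)
have -> : redmx m (Tmx A X) = invmx X *m redmx m B + defect A B X.
  by rewrite redmxM liftmxK addrC subrK.
rewrite scalerDr (_ : _ *: defect A B X = 0) ?addr0 // -natrX.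
have -> : (d ^ 2 = s * (d * p))%N by rewrite -mulnn {2}d_eq mulnCA.
by rewrite natrM -scalerA D0 scaler0.
Qed.

Theorem proposition1p1 (R : realType) (p n k : nat) (A B : 'M[int]_n)
    (p_prime : prime p) (n_ge1 : (1 <= n)%N) (k_gt1 : (1 < k)%N)
    (gcdABp : ~ forall i j : 'I_n, (p%:Z %| A i j)%Z /\ (p%:Z %| B i j)%Z) :
  (forall l : nat, k = (2 * l)%N ->
     kloosterman R A B (p ^ k) =
     \sum_(X : 'M['Z_(p ^ k)]_n | (X \in unitmx) && XAX_eq_mod A B (p ^ l) X)
        kterm R A B X)
  /\
  (forall l : nat, k = (2 * l + 1)%N ->
     kloosterman R A B (p ^ k) =
     ((p ^ (n ^ 2))%:R)^-1 *
     \sum_(X : 'M['Z_(p ^ k)]_n | (X \in unitmx) && XAX_eq_mod A B (p ^ l) X)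
        kterm R A B X * gauss_sum R A B p (p ^ l) X).
Proof.
have p_gt1 := prime_gt1 p_prime.
have m_gt1 : (1 < p ^ k)%N by rewrite -(exp1n k) ltn_exp2r; lia.
have card_neq0 (d : nat) : (1 < d)%N -> (d ^ (n * n))%:R != 0 :> R[i].
  by move=> d_gt1; rewrite pnatr_eq0 expn_eq0; lia.
split=> l k_eq; apply: (mulfI (card_neq0 _ m_gt1)).
  have m_eq : (p ^ k = p ^ l * p ^ l)%N by rewrite -expnD; congr expn; lia.
  rewrite (kloosterman_localized R _ (p ^ l) 1) ?muln1 ?dvd1n // mulr_sumr.
  apply: eq_bigr => X /andP[X_unit X_stat].
  by rewrite quad_sum_even // mulrC.
have m_eq : (p ^ k = p ^ l * (p ^ l * p))%N.
  by rewrite -expnSr -expnD; congr expn; lia.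
have p_d : (p %| p ^ l)%N by apply: dvdn_exp => //; lia.
rewrite (kloosterman_localized R _ (p ^ l) p) // mulrA mulr_sumr.
apply: eq_bigr => X /andP[X_unit X_stat].
apply: (mulfI (card_neq0 _ p_gt1)).
rewrite (mulrCA _ (kterm _ _ _ _)) quad_sum_odd // -mulnn.
by field; exact: card_neq0.
Qed.
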